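(* Let $\mathbf{A}\in\mathbb{R}^{n\times n}$, $\mathbf{B}\in\mathbb{R}^{n\times m}$, let $N\ge n$ be an integer, let $\Delta\mathbf{x}\in\mathbb{R}^n$, and let $\mathcal{C}_N=[\mathbf{B},\mathbf{A}\mathbf{B},\dots,\mathbf{A}^{N-1}\mathbf{B}]$. Let $\mathbf{y}\in\mathbb{R}^n$ be a valid uncontrollability certificate, i.e. $\mathcal{C}_N^\top\mathbf{y}=\mathbf{0}$ and $\mathbf{y}^\top\Delta\mathbf{x}\neq0$. Let $$\mathcal{K}_r(\mathbf{A}^\top,\mathbf{y})=\mathrm{span}\{\mathbf{y},\mathbf{A}^\top\mathbf{y},\dots,(\mathbf{A}^\top)^{r-1}\mathbf{y}\}$$ be the $\mathbf{A}^\top$-invariant Krylov subspace generated by $\mathbf{y}$, where $r$ is the minimal dimension such that $\mathbf{A}^\top\mathcal{K}_r\subseteq\mathcal{K}_r$. Let $\mathcal{I}$ index the distinct uncontrollable eigenvalues $\lambda_j$ of $(\mathbf{A},\mathbf{B})$, and let $\mathcal{I}_{\mathbf{y}}\subseteq\mathcal{I}$ index those uncontrollable eigenvalues whose generalized eigenspace (of $\mathbf{A}^\top$) contains vectors appearing with a nonzero coefficient in the expression of $\mathbf{y}$ as a linear combination of generalized eigenvectors of $\mathbf{A}^\top$. Then the set of eigenvalues of the restricted operator $\mathbf{A}^\top|_{\mathcal{K}_r}$ is exactly the set $\{\lambda_j\}_{j\in\mathcal{I}_{\mathbf{y}}}$ of uncontrollable eigenvalues that contribute to the certificate $\mathbf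{y}$.
   Context: The setting is the discrete-time linear time-invariant system $\mathbf{x}_{k+1}=\mathbf{A}\mathbf{x}_k+\mathbf{B}\mathbf{u}_k$ with $\mathbf{x}_k\in\mathbb{R}^n$, $\mathbf{u}_k\in\mathbb{R}^m$; $\mathbf{A}$ is not assumed diagonalizable. An eigenvalue $\lambda$ of $\mathbf{A}$ is an uncontrollable eigenvalue of $(\mathbf{A},\mathbf{B})$ if there is a nonzero vector $\mathbf{w}$ with $\mathbf{w}^\top\mathbf{A}=\lambda\mathbf{w}^\top$ and $\mathbf{w}^\top\mathbf{B}=\mathbf{0}$. Convention: eigenvalues and generalized eigenvectors may be complex; $^\top$ is the plain (non-conjugate) transpose, $\mathbf{y}$ is regarded as a vector in $\mathbb{C}^n$, and eigenvalues of $\mathbf{A}^\top|_{\mathcal{K}_r}$ are taken over $\mathbb{C}$ (equivalently $\mathcal{K}_r$ is taken as a complex span). Since $\mathbb{C}^n$ is the direct sum of the generalized eigenspaces $\ker(\mathbf{A}^\top-\lambda\mathbf{I})^n$ of $\mathbf{A}^\top$ over its distinct eigenvalues $\lambda$, the condition $j\in\mathcal{I}_{\mathbf{y}}$ means that $\lambda_j$ is an uncontrollable eigenvalue and the component of $\mathbf{y}$ in the generalized eigenspace of $\lambda_j$ in this decomposition is nonzero. *)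

(* Defs.v *)
From HB Require Import structures.
From mathcomp Require Import all_boot all_order all_algebra.
From mathcomp Require Import complex reals.

Set Implicit Arguments.
Unset Strict Implicit.
Unset Printing Implicit Defensive.

Import Order.TTheory GRing.Theory Num.Theory.
Local Open Scope ring_scope.
Local Open Scope complex_scope.

(* Vectors are columns and a matrix M : 'M_n stands for the operator x |-> M *m x.
   The subspaces, eigenspaces and restrictions of mxalgebra and mxpoly are row
   spaces with matrices acting on the right, so a column x is represented there
   by x^T and the operator M by M^T, as (M *m x)^T = x^T *m M^T. *)

Definition ctrb (F : fieldType) (n m N : nat) (A : 'M[F]_n) (B : 'M[F]_(n, m)) :
    'M[F]_(n, \sum_(k < N) m) :=
  \mxrow_(k < N) (A ^+ k *m B).

(* The row space of krylov M y r is span {y, M y, ..., M^(r-1) y}. *)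
Definition krylov (F : fieldType) (n : nat) (M : 'M[F]_n) (y : 'cV[F]_n)
    (r : nat) : 'M[F]_(r, n) :=
  \matrix_(k < r) (M ^+ k *m y)^T.

(* Dimension 0 is excluded: the empty span is trivially invariant, but it is not
   the Krylov subspace generated by a nonzero y. *)
Definition is_krylov_dim (F : fieldType) (n : nat) (M : 'M[F]_n) (y : 'cV[F]_n)
    (r : nat) : Prop :=
  [/\ (0 < r)%N,
      stablemx (krylov M y r) M^T
    & forall s : nat, (0 < s)%N -> stablemx (krylov M y s) M^T -> (r <= s)%N].

(* Matrix of the operator M restricted to the M-invariant subspace spanned by
   the rows of K, in the basis row_base K. *)
Definition restriction (F : fieldType) (n p : nat) (K : 'M[F]_(p, n))
    (M : 'M[F]_n) : 'M[F]_(\rank K) :=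
  restrictmx K M^T.

Definition complexify (R : realType) (p q : nat) (M : 'M[R]_(p, q)) :
    'M[R[i]]_(p, q) :=
  map_mx (real_complex R) M.

Definition uncontrollable_eigenvalue (F : fieldType) (n m : nat) (A : 'M[F]_n)
    (B : 'M[F]_(n, m)) (l : F) : Prop :=
  eigenvalue A l /\
  exists w : 'cV[F]_n, [/\ w != 0, w^T *m A = l *: w^T & w^T *m B = 0].

(* s enumerates the distinct eigenvalues of M, and y is the sum over them of the
   vectors v mu, each in the generalized eigenspace ker (M - mu I)^n. *)
Definition geigen_decomposition (F : fieldType) (n : nat) (M : 'M[F]_n)
    (y : 'cV[F]_n) (s : seq F) (v : F -> 'cV[F]_n) : Prop :=
  [/\ uniq s,
      forall mu : F, (mu \in s) = eigenvalue M^T mu,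
      forall mu : F, mu \in s -> ((v mu)^T <= geigenspace M^T mu)%MS
    & y = \sum_(mu <- s) v mu].

(* The generalized eigenspaces of distinct eigenvalues are independent, so the
   component v l does not depend on the decomposition. *)
Definition contributes (F : fieldType) (n : nat) (M : 'M[F]_n) (y : 'cV[F]_n)
    (l : F) : Prop :=
  exists (s : seq F) (v : F -> 'cV[F]_n),
    [/\ geigen_decomposition M y s v, l \in s & v l != 0].

(* Main.v *)
(* Write u = y^T and let K be the span of the u A^i, with A acting on the right.
   Over the complex numbers an eigenvalue of the restriction of A to K is one
   with an eigenvector w in K. By Cayley-Hamilton the certificate condition gives
   K B = 0, so every such w witnesses uncontrollability. Let q be the product of
   the (X - mu)^n over the eigenvalues mu other than l, so that u q(A) = u_l q(A)
   with u_l the component of u at l. If u_l = 0, then q(A) annihilates u, hence K,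
   hence every eigenvector w in K for l, although w q(A) = q(l) w is nonzero. If
   u_l is nonzero, then u q(A) is a nonzero vector of K killed by (A - l)^n, since
   q is coprime to (X - l)^n, and its last nonzero image under the powers of A - l
   is an eigenvector in K. *)

Require Import Defs.
From HB Require Import structures.
From mathcomp Require Import all_boot all_order all_algebra.
From mathcomp Require Import complex reals.

Set Implicit Arguments.
Unset Strict Implicit.
Unset Printing Implicit Defensive.

Import Order.TTheory GRing.Theory Num.Theory.
Local Open Scope ring_scope.
Local Open Scope complex_scope.

(** * Polynomials in a matrix, and eigenvectors in invariant subspaces *)

Lemma horner_mxE (F : fieldType) (n : nat) (A : 'M[F]_n.+1) (p : {poly F}) :
  horner_mx A p = \sum_(i < size p) p`_i *: A ^+ i.
Proof.
rewrite -{1}[p]coefK poly_def rmorph_sum; apply: eq_bigr => i _.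
by rewrite /= horner_mxZ rmorphXn /= horner_mx_X.
Qed.

(* By Cayley-Hamilton only the remainder modulo the characteristic polynomial
   matters, and it has degree at most n. *)
Lemma mul_horner_mx_eq0 (F : fieldType) (n m k : nat) (A : 'M[F]_n.+1)
    (u : 'M[F]_(k, n.+1)) (B : 'M[F]_(n.+1, m)) (p : {poly F}) :
  (forall i : nat, (i < n.+1)%N -> u *m A ^+ i *m B = 0) ->
  u *m horner_mx A p *m B = 0.
Proof.
move=> uAB0; rewrite (divp_eq p (char_poly A)) rmorphD rmorphM /=.
rewrite Cayley_Hamilton mulr0 add0r horner_mxE mulmx_sumr mulmx_suml.
rewrite big1 // => i _; rewrite -scalemxAr -scalemxAl uAB0 ?scaler0 //.
rewrite (leq_trans (ltn_ord i)) // -ltnS -(size_char_poly A).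
by rewrite ltn_modp monic_neq0 ?char_poly_monic.
Qed.

Lemma exists_eigenvector (F : fieldType) (n p k : nat) (A : 'M[F]_n.+1)
    (K : 'M[F]_(p, n.+1)) (l : F) (z : 'rV[F]_n.+1) :
  stablemx K A -> (z <= K)%MS -> z != 0 -> z *m (A - l%:M) ^+ k = 0 ->
  exists w : 'rV[F]_n.+1, [/\ (w <= K)%MS, w != 0 & w *m A = l *: w].
Proof.
move=> stabK; elim: k z => [|k IHk] z zK z_neq0.
  by rewrite expr0 mulmx1 => z0; rewrite z0 eqxx in z_neq0.
rewrite exprS -mulmxE mulmxA => zA0.
have [zA|zA_neq0] := eqVneq (z *m (A - l%:M)) 0; last first.
  apply: IHk zA_neq0 zA0; apply: submx_trans (submxMr _ zK) _.
  by rewrite stablemxD ?stablemxN ?stablemxC.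
exists z; split=> //; apply/eqP.
by rewrite -subr_eq0 -mul_mx_scalar -mulmxBr zA.
Qed.

(** Since [V] is row free, [v |-> v *m V] is injective and carries the eigenvectors of [conjmx V A]
    onto those of [A] lying in [V]. *)
Lemma eigenvalue_conjmxP (F : fieldType) (n p : nat) (A : 'M[F]_n)
    (V : 'M[F]_(p, n)) (l : F) : stablemx V A -> row_free V ->
  eigenvalue (conjmx V A) l <->
  exists w : 'rV[F]_n, [/\ (w <= V)%MS, w != 0 & w *m A = l *: w].
Proof.
move=> stabV freeV; split.
  case/rowV0Pn => v; rewrite sub_eigenspace_conjmx // => /eigenspaceP vVA v_neq0.
  exists (v *m V); split=> //; first exact: submxMl.
  by rewrite -(mul0mx _ V) (inj_eq (row_free_inj freeV)).
case=> w [/submxP[v ->] vV_neq0 vVA]; apply/rowV0Pn; exists v.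
  by rewrite sub_eigenspace_conjmx //; apply/eigenspaceP.
by apply: contraNneq vV_neq0 => ->; rewrite mul0mx.
Qed.

Lemma horner_mx_eigen (F : fieldType) (n : nat) (A : 'M[F]_n.+1) (l : F)
    (w : 'rV[F]_n.+1) (p : {poly F}) :
  w *m A = l *: w -> w *m horner_mx A p = p.[l] *: w.
Proof.
move=> wA; elim/poly_ind: p => [|p c IHp].
  by rewrite rmorph0 mulmx0 horner0 scale0r.
rewrite rmorphD rmorphM /= horner_mx_X horner_mx_C mulmxDr -mulmxE mulmxA IHp.
by rewrite -scalemxAl wA mul_mx_scalar !hornerE scalerDl scalerA.
Qed.

(** * Generalized eigenspaces and primary decomposition *)

Section GeneralizedEigenspaces.

Variables (F : fieldType) (n : nat).

(** The exponent is the dimension, as in [geigenspace], so the kernel of each factor is a full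
    generalized eigenspace. *)
Definition geigen_poly (s : seq F) : {poly F} :=
  \prod_(mu <- s) ('X - mu%:P) ^+ n.+1.

Variable (A : 'M[F]_n.+1).

Lemma root_geigen_poly (s : seq F) (l : F) : root (geigen_poly s) l = (l \in s).
Proof.
rewrite /geigen_poly; elim: s => [|mu s IHs].
  by rewrite big_nil (negPf (root1 l)).
by rewrite big_cons rootM IHs root_exp_XsubC inE.
Qed.

Lemma coprimep_geigen_poly (s : seq F) (l : F) : l \notin s ->
  coprimep (('X - l%:P) ^+ n.+1) (geigen_poly s).
Proof.
move=> ls; apply: coprimep_expl; rewrite coprimep_sym coprimep_XsubC.
by rewrite root_geigen_poly.
Qed.

Lemma geigen_poly_sum_eq0 (s : seq F) (v : F -> 'rV[F]_n.+1) (P : pred F) :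
  (forall mu, mu \in s -> (v mu <= geigenspace A mu)%MS) ->
  (\sum_(mu <- s | P mu) v mu) *m horner_mx A (geigen_poly (filter P s)) = 0.
Proof.
move=> vA; rewrite mulmx_suml -big_filter big_seq big1 // => mu mu_Ps.
have mu_s : mu \in s by move: mu_Ps; rewrite mem_filter => /andP[].
rewrite /geigen_poly (big_rem mu) //= rmorphM -mulmxE mulmxA.
by move/vA/sub_kermxP: mu_s => ->; rewrite mul0mx.
Qed.

Lemma geigen_poly_decomposition (s : seq F) (u : 'rV[F]_n.+1) : uniq s ->
  (u <= kermxpoly A (geigen_poly s))%MS ->
  exists2 v : F -> 'rV[F]_n.+1,
    forall mu, mu \in s -> (v mu <= geigenspace A mu)%MS
    & u = \sum_(mu <- s) v mu.
Proof.
elim: s u => [|l s IHs] u /=.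
  rewrite /geigen_poly big_nil kermxpoly1 submx0 => _ /eqP ->.
  by exists (fun=> 0) => //; rewrite big_nil.
case/andP=> ls uniq_s; rewrite /geigen_poly big_cons -/(geigen_poly s).
rewrite kermxpolyM ?coprimep_geigen_poly // => /sub_addsmxP[[a b] /= ->].
have [v vA bE] := IHs _ uniq_s (submxMl b _).
(* As [l] is not in [s], redefining the family at [l] leaves the sum over [s] unchanged. *)
exists (fun mu => if mu == l then a *m geigenspace A l else v mu).
  move=> mu; rewrite inE; case: eqP => [-> _ | _ /=]; first exact: submxMl.
  exact: vA.
rewrite big_cons eqxx; congr (_ + _); rewrite bE.
by apply: eq_big_seq => mu; case: eqP => // ->; rewrite (negPf ls).
Qed.

End GeneralizedEigenspaces.

Arguments geigen_poly {F} n s.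

(** The characteristic polynomial splits, and no root has multiplicity above the dimension; hence it
    divides [geigen_poly] of its distinct roots, whose kernel is then the whole space. *)
Lemma exists_geigen_decomposition (F : closedFieldType) (n : nat)
    (M : 'M[F]_n.+1) (y : 'cV[F]_n.+1) :
  exists s v, geigen_decomposition M y s v.
Proof.
have [rs chiE] := closed_field_poly_normal (char_poly M^T).
rewrite (monicP (char_poly_monic _)) scale1r in chiE.
have size_rs : size rs = n.+1.
  by apply: succn_inj; rewrite -(size_prod_XsubC rs id) -chiE size_char_poly.
have : (y^T <= kermxpoly M^T (geigen_poly n (undup rs)))%MS.
  apply: (submx_trans (submx1 _)); rewrite kermxpoly_min //.
  apply: dvdp_trans (mxminpoly_dvd_char _) _; rewrite chiE.
  rewrite -prodr_undup_exp_count /geigen_poly.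
  apply: (big_ind2 (fun p q => p %| q)) => [|p1 p2 q1 q2|mu _] //.
    exact: dvdp_mul.
  by rewrite dvdp_exp2l // -size_rs count_size.
case/(geigen_poly_decomposition (undup_uniq rs)) => v vA yE.
exists (undup rs), (fun mu => (v mu)^T); split.
- exact: undup_uniq.
- by move=> mu; rewrite eigenvalue_root_char chiE root_prod_XsubC mem_undup.
- by move=> mu mu_s; rewrite trmxK vA.
- by rewrite -[LHS]trmxK yE linear_sum.
Qed.

(** The first hypothesis is all that is needed of [K] being generated by [y]: a polynomial that
    kills [y] kills [K]. *)
Lemma geigen_component_neq0 (F : fieldType) (n p : nat) (M : 'M[F]_n.+1)
    (y : 'cV[F]_n.+1) (K : 'M[F]_(p, n.+1)) (s : seq F) (v : F -> 'cV[F]_n.+1)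
    (l : F) (w : 'rV[F]_n.+1) :
  (forall q, y^T *m horner_mx M^T q = 0 -> K *m horner_mx M^T q = 0) ->
  geigen_decomposition M y s v ->
  (w <= K)%MS -> w != 0 -> w *m M^T = l *: w -> l \in s /\ v l != 0.
Proof.
move=> genK [uniq_s sE vM yE] wK w_neq0 wM.
have ls : l \in s by rewrite sE; apply/eigenvalueP; exists w.
split=> //; apply/eqP => vl0.
pose q := geigen_poly n [seq mu <- s | mu != l].
have yq : y^T *m horner_mx M^T q = 0.
  rewrite yE linear_sum /= (bigID (fun mu => mu == l)) /= big1_seq; last first.
    by move=> mu /andP[/eqP -> _]; rewrite vl0 trmx0.
  rewrite add0r.
  exact: (@geigen_poly_sum_eq0 _ _ _ s (fun mu => (v mu)^T) (predC1 l)).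
have wq : w *m horner_mx M^T q = 0.
  by case/submxP: wK => a ->; rewrite -mulmxA genK ?mulmx0.
move/eqP: wq; rewrite (horner_mx_eigen _ wM) scaler_eq0 (negPf w_neq0) orbF.
by apply/negP; rewrite -/(root q l) root_geigen_poly mem_filter eqxx.
Qed.

Lemma exists_eigenvector_of_component (F : fieldType) (n p : nat)
    (M : 'M[F]_n.+1) (y : 'cV[F]_n.+1) (K : 'M[F]_(p, n.+1)) (s : seq F)
    (v : F -> 'cV[F]_n.+1) (l : F) :
  stablemx K M^T -> (y^T <= K)%MS ->
  geigen_decomposition M y s v -> l \in s -> v l != 0 ->
  exists w : 'rV[F]_n.+1, [/\ (w <= K)%MS, w != 0 & w *m M^T = l *: w].
Proof.
move=> stabK yK [uniq_s sE vM yE] ls vl_neq0.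
pose q := geigen_poly n [seq mu <- s | mu != l].
have yq : y^T *m horner_mx M^T q = (v l)^T *m horner_mx M^T q.
  rewrite yE linear_sum /= (bigD1_seq l) //= mulmxDl [X in _ + X](_ : _ = 0).
    by rewrite addr0.
  exact: (@geigen_poly_sum_eq0 _ _ _ s (fun mu => (v mu)^T) (predC1 l)).
have cop : coprimep (('X - l%:P) ^+ n.+1) q.
  by apply: coprimep_geigen_poly; rewrite mem_filter eqxx.
have vlM := vM l ls.
apply: (@exists_eigenvector _ _ _ n.+1 _ _ _ (y^T *m horner_mx M^T q)) => //.
(* [<<K>>] spans the same space with exactly [n.+1] rows, whatever [p] is, a shape to which
   [horner_mx_stable] applies. *)
- have stabG : stablemx <<K>>%MS M^T by rewrite (eqmx_stable _ (genmxE K)).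
  rewrite -(genmxE K); apply: submx_trans (horner_mx_stable q stabG).
  by rewrite submxMr // genmxE.
(* Otherwise [v l] would lie in the kernels of two coprime polynomials, which meet only in 0. *)
- rewrite yq; apply: contraNneq vl_neq0 => vlq.
  rewrite -trmx_eq0 -submx0 -(mxdirect_kermxpoly M^T cop) sub_capmx.
  by rewrite vlM; apply/sub_kermxP.
have -> : (M^T - l%:M) ^+ n.+1 = horner_mx M^T (('X - l%:P) ^+ n.+1).
  by rewrite rmorphXn /= rmorphB /= horner_mx_X horner_mx_C.
rewrite yq -mulmxA mulmxE -rmorphM mulrC rmorphM -mulmxE mulmxA.
by move/sub_kermxP: vlM => ->; rewrite mul0mx.
Qed.

(** * Krylov subspaces and the restricted operator *)

Lemma row_krylov (F : fieldType) (n r : nat) (M : 'M[F]_n) (y : 'cV[F]_n)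
    (i : 'I_r) : row i (krylov M y r) = y^T *m M^T ^+ i.
Proof.
rewrite rowK trmx_mul; congr (_ *m _); elim: (i : nat) => [|k IHk].
  by rewrite !expr0 trmx1.
by rewrite exprSr exprS -!mulmxE trmx_mul IHk.
Qed.

Lemma map_krylov (F L : fieldType) (f : {rmorphism F -> L}) (n r : nat)
    (M : 'M[F]_n) (y : 'cV[F]_n) :
  map_mx f (krylov M y r) = krylov (map_mx f M) (map_mx f y) r.
Proof.
apply/row_matrixP => i.
by rewrite -map_row !row_krylov map_mxM rmorphXn /= !map_trmx.
Qed.

Lemma krylov_mul_eq0 (F : fieldType) (n m r : nat) (M : 'M[F]_n)
    (y : 'cV[F]_n) (B : 'M[F]_(n, m)) :
  (forall i, y^T *m M^T ^+ i *m B = 0) -> krylov M y r *m B = 0.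
Proof.
by move=> yB; apply/row_matrixP => i; rewrite row_mul row_krylov yB row0.
Qed.

Lemma ctrb_mul_eq0 (F : fieldType) (n m N : nat) (A : 'M[F]_n)
    (B : 'M[F]_(n, m)) (y : 'cV[F]_n) (i : nat) :
  (ctrb N A B)^T *m y = 0 -> (i < N)%N -> y^T *m A ^+ i *m B = 0.
Proof.
move=> /(congr1 trmx); rewrite trmx_mul trmxK trmx0 mul_mxrow => yC iN.
have := congr1 (fun X => submxrow X (Ordinal iN)) yC.
by rewrite mxrowK submxrow0 mulmxA.
Qed.

(** The image under [f] of [row_base K] need not be the chosen basis of the extended space, but it
    is still free and spans it, which suffices for the eigenvalues. *)
Lemma eigenvalue_restrictionP (F : fieldType) (L : fieldType)
    (f : {rmorphism F -> L}) (n p : nat) (K : 'M[F]_(p, n)) (M : 'M[F]_n) l :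
  stablemx K M^T ->
  eigenvalue (map_mx f (restriction K M)) l <->
  exists w : 'rV[L]_n,
    [/\ (w <= map_mx f K)%MS, w != 0 & w *m map_mx f M^T = l *: w].
Proof.
move=> stabK; rewrite /restriction /conjmx 2!map_mxM map_pinvmx.
rewrite -/(conjmx (map_mx f (row_base K)) (map_mx f M^T)).
have eqK : (map_mx f (row_base K) :=: map_mx f K)%MS.
  by apply/eqmxP; rewrite !map_submx !eq_row_base submx_refl.
rewrite eigenvalue_conjmxP ?row_free_map ?row_base_free //; last first.
  by rewrite -map_mxM map_submx stablemx_row_base.
by split=> -[w [wK w_neq0 wM]]; exists w; split; rewrite // ?eqK // -eqK.
Qed.

Theorem theorem2 (R : realType) (n m N : nat) (A : 'M[R]_n) (B : 'M[R]_(n, m))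
    (dx y : 'cV[R]_n) (r : nat) :
  (n <= N)%N ->
  (ctrb N A B)^T *m y = 0 ->
  y^T *m dx != 0 ->
  is_krylov_dim A^T y r ->
  forall l : R[i],
    eigenvalue (complexify (restriction (krylov A^T y r) A^T)) l <->
    uncontrollable_eigenvalue (complexify A) (complexify B) l /\
    contributes (complexify A^T) (complexify y) l.
Proof.
(* In dimension 0 the product [y^T *m dx] vanishes, against the certificate. *)
case: n A B dx y => [|n] A B dx y nN yC ydx [r_gt0 stabK _] l.
  by rewrite [dx]flatmx0 mulmx0 eqxx in ydx.
have KB : krylov A^T y r *m B = 0.
  (* Here [i] is arbitrary and may exceed [N]; Cayley-Hamilton brings it back to powers below
     [n.+1], which [N] covers. *)
  apply: krylov_mul_eq0 => i; rewrite trmxK.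
  rewrite -(horner_mx_X A) -rmorphXn /=; apply: mul_horner_mx_eq0 => j j_n.
  by apply: ctrb_mul_eq0 yC _; apply: leq_trans nN.
set M := complexify A^T; set u := complexify y.
have ME : M^T = complexify A by rewrite /M /complexify map_trmx trmxK.
have KE : complexify (krylov A^T y r) = krylov M u r by apply: map_krylov.
have stabM : stablemx (krylov M u r) M^T.
  by rewrite -KE ME -map_mxM map_submx; rewrite trmxK in stabK.
(* The first row is [u^T]; it exists because [r] is positive. *)
have uK : (u^T <= krylov M u r)%MS.
  have := row_sub (Ordinal r_gt0) (krylov M u r).
  by rewrite row_krylov expr0 mulmx1.
have genK q : u^T *m horner_mx M^T q = 0 -> krylov M u r *m horner_mx M^T q = 0.
  move=> uq; apply: krylov_mul_eq0 => i; rewrite -mulmxA.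
  (* The power is written as a polynomial in [M^T] so that it commutes with [q]. *)
  rewrite -{1}(horner_mx_X M^T) -rmorphXn /= mulmxE -rmorphM mulrC rmorphM.
  by rewrite -mulmxE mulmxA uq mul0mx.
rewrite /complexify eigenvalue_restrictionP // trmxK.
rewrite -/(complexify (krylov A^T y r)) -/(complexify A) KE -ME.
split; last first.
  case=> _ [s [v [dec ls vl]]].
  exact: exists_eigenvector_of_component dec ls vl.
case=> w [wK w_neq0 wM]; split.
  split; first by apply/eigenvalueP; exists w.
  exists w^T; rewrite trmxK trmx_eq0; split=> //.
  case/submxP: wK => a ->; rewrite -KE -mulmxA -map_mxM KB.
  by rewrite map_mx0 mulmx0.
have [s [v dec]] := exists_geigen_decomposition M u.
have [ls vl] := geigen_component_neq0 genK dec wK w_neq0 wM.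
by exists s, v.
Qed.
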